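(* Consider the precoded OFDM system and the quantity $\mathrm{SINR}_i$ defined in the context, with $L\le N_{\rm fft}$, and let $\tau_{\rm tr}\le L$ be a truncation threshold. Suppose every subcarrier $l\in\{0,\dots,N_{\rm sc}-1\}$ uses the time-frequency precoder $$\mathbf{w}_l=\mathbf{w}_l(\tau_{\rm tr})=\frac{\hat{\mathbf{h}}_l^{*}(\tau_{\rm tr})}{\|\hat{\mathbf{h}}_l(\tau_{\rm tr})\|},\qquad \hat{\mathbf{h}}_l(\tau_{\rm tr})=\sum_{p=0}^{\tau_{\rm tr}-1}\mathbf{h}_p e^{-\mathrm{j}2\pi lp/N_{\rm fft}}.$$ Let $N_{\rm t}\to\infty$ with $\mathrm{SNR}_{\rm op}=N_{\rm t}\,\mathrm{SNR}>0$ fixed. Then for every $i\in\{0,\dots,N_{\rm sc}-1\}$, almost surely, $\mathrm{SINR}_i$ converges to $$\mathrm{SINR}_i^{\infty}(\tau_{\rm tr})=\frac{\left(\sum_{p=0}^{\tau_{\rm tr}-1}c[p]E_p\right)^2}{\sum_{l=0}^{N_{\rm sc}-1}2\left|\sum_{p=N_{\rm cp}+1}^{\tau_{\rm tr}-1}\tilde c_{l,i}[p]E_p\right|^2+\alpha_{\tau_{\rm tr}}^2\,\mathrm{SNR}_{\rm op}^{-1}},$$ where $\alpha_{\tau_{\rm tr}}^2=\sum_{p=0}^{\tau_{\rm tr}-1}E_p$ (empty sums are $0$).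
   Context: **Parameters.** $N_{\rm fft}\ge1$ (FFT size), $1\le N_{\rm sc}\le N_{\rm fft}$ (number of occupied subcarriers), $N_{\rm cp}\ge0$ (cyclic prefix length), $L\ge1$ (number of channel taps), $1\le\tau_{\rm tr}\le L$ (truncation threshold) and $N_{\rm t}\ge1$ (number of transmit antennas) are integers; $\mathrm{j}=\sqrt{-1}$. Superscripts $*$ and $\mathrm T$ denote complex conjugate and transpose. All parameters other than $N_{\rm t}$ (and $\mathrm{SNR}=\mathrm{SNR}_{\rm op}/N_{\rm t}$) are fixed as $N_{\rm t}\to\infty$. **Channel.** For $p=0,\dots,L-1$ the tap vector $\mathbf{h}_p=\mathbf{h}[p]\in\mathbb{C}^{N_{\rm t}}$ has i.i.d. zero-mean circularly-symmetric complex normal entries of variance $E_p\ge0$, and the taps are mutually independent. To let $N_{\rm t}\to\infty$, the entries of $\mathbf{h}_p$ are taken to be the first $N_{\rm t}$ terms of an infinite i.i.d. sequence, these sequences being independent for different $p$. It is assumed that $\sum_{p=0}^{\tau_{\rm tr}-1}E_p>0$, so that the precoders are well defined almost surely. **Weight functions.** $$c[m]=\begin{cases}\frac{N_{\rm fft}+m}{N_{\rm fft}}& -N_{\rm fft}\le m\le0\\ 1&0\le m\le N_{\rm cp}\\ \frac{N_{\rm fft}-(m-N_{\rm cp})}{N_{\rm fft}}& N_{\rm cp}\le m\le N_{\rm fft}+N_{\rm cp}\\ 0&\text{otherwise,}\end{cases}$$ for $l\ne i$, $$\tilde c_{l,i}[m]=\begin{cases}\dfrac{1-e^{\mathrm{j}2\pi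 m(l-i)/N_{\rm fft}}}{N_{\rm fft}\left(1-e^{\mathrm{j}2\pi(l-i)/N_{\rm fft}}\right)}& -N_{\rm fft}\le m\le0\\[2mm] \dfrac{e^{\mathrm{j}2\pi(m-N_{\rm cp})(l-i)/N_{\rm fft}}-1}{N_{\rm fft}\left(1-e^{\mathrm{j}2\pi(l-i)/N_{\rm fft}}\right)}& N_{\rm cp}\le m\le N_{\rm fft}+N_{\rm cp}\\ 0&\text{otherwise,}\end{cases}$$ and $\tilde c_{i,i}[m]=(1-c[m])/\sqrt2$. **OFDM channels.** For subcarriers $i,l\in\{0,\dots,N_{\rm sc}-1\}$, $$\hat{\mathbf{h}}_i=\sum_{p=0}^{L-1}\mathbf{h}_pe^{-\mathrm{j}2\pi ip/N_{\rm fft}},\qquad \hat{\mathbf{h}}_{0,i,i}=\sum_{m=0}^{L-1}c[m]\mathbf{h}[m]e^{-\mathrm{j}2\pi im/N_{\rm fft}},$$ $$\hat{\mathbf{h}}_{0,l,i}=\sum_{m=N_{\rm cp}}^{L-1}\tilde c_{l,i}[m]\mathbf{h}[m]e^{-\mathrm{j}2\pi lm/N_{\rm fft}}\quad(l\ne i).$$ **SINR.** With precoders $\mathbf{w}_l\in\mathbb{C}^{N_{\rm t}}$ and signal-to-noise ratio $\mathrm{SNR}>0$, the SINR on subcarrier $i$ (accounting for inter-carrier and inter-symbol interference) is $$\mathrm{SINR}_i=\frac{|\hat{\mathbf{h}}_{0,i,i}^{\mathrm T}\mathbf{w}_i|^2}{|\mathbf{w}_i^{\mathrm T}(\hat{\mathbf{h}}_i-\hat{\mathbf{h}}_{0,i,i})|^2+\sum_{l=0,\,l\ne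 i}^{N_{\rm sc}-1}2|\hat{\mathbf{h}}_{0,l,i}^{\mathrm T}\mathbf{w}_l|^2+1/\mathrm{SNR}}.$$ *)

(* Defs.v *)
From HB Require Import structures.
From mathcomp Require Import all_boot all_order all_algebra.
From mathcomp Require Import all_classical all_reals all_analysis.
From mathcomp Require Import finmap complex.

Set Implicit Arguments.
Unset Strict Implicit.
Unset Printing Implicit Defensive.

Import Order.TTheory GRing.Theory Num.Theory.
Import numFieldNormedType.Exports.

Local Open Scope classical_set_scope.
Local Open Scope ring_scope.
Local Open Scope complex_scope.

Import Normc.

Section probability_notions.
Context (d : measure_display) (T : measurableType d) (R : realType).
Variable P : probability T R.

(* Mutual independence: the product rule over every finite subfamily. *)
Definition mutually_independent (I : choiceType) (F : I -> set_system T) :=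
  forall (J : {fset I}) (A : I -> set T),
    (forall i, i \in J -> F i (A i)) ->
    P (\bigcap_(i in [set` J]) A i) = (\prod_(i <- J) P (A i))%E.

(* R[i] carries no sigma-algebra in the library, so it is identified with
   R * R through the real and imaginary parts. *)
Definition sigma_of (Z : T -> R[i]) : set_system T :=
  g_sigma_algebra_preimage (fun t => (complex.Re (Z t), complex.Im (Z t))).

Definition sigma_of_seq (Z : nat -> T -> R[i]) : set_system T :=
  <<s \bigcup_k sigma_of (Z k) >>.

(* normal_prob takes the standard deviation, and for standard deviation 0 it
   is the uniform law on [0, 1]; the degenerate case has to be the point mass. *)
Definition centered_normal (v : R) (A : set R) : \bar R :=
  if v == 0 then dirac (0 : R) A else normal_prob 0 (Num.sqrt v) A.

(* Z is CN(0, v), so E |Z|^2 = v: the real and imaginary parts are independent,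
   each of law N(0, v / 2). *)
Definition circular_normal (Z : T -> R[i]) (v : R) : Prop :=
  [/\ measurable_fun setT (fun t => complex.Re (Z t)),
      measurable_fun setT (fun t => complex.Im (Z t)) &
      forall A B : set R, measurable A -> measurable B ->
        P [set t | A (complex.Re (Z t)) /\ B (complex.Im (Z t))] =
        (centered_normal (v / 2) A * centered_normal (v / 2) B)%E].

End probability_notions.

Section ofdm.
Context (R : realType).
Variables (Nfft Nsc Ncp L : nat).

Definition expj (theta : R) : R[i] := cos theta +i* sin theta.

Definition c_weight (m : int) : R :=
  if - Nfft%:Z <= m <= 0 then (Nfft%:Z + m)%:~R / Nfft%:R
  else if 0 <= m <= Ncp%:Z then 1
  else if Ncp%:Z <= m <= Nfft%:Z + Ncp%:Z then
    (Nfft%:Z - (m - Ncp%:Z))%:~R / Nfft%:R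
  else 0.

Definition ctilde (l i : nat) (m : int) : R[i] :=
  let phase (k : int) := expj (2 * pi * k%:~R * (l%:R - i%:R) / Nfft%:R) in
  if l == i then ((1 - c_weight m) / Num.sqrt 2)%:C
  else if - Nfft%:Z <= m <= 0 then
    (1 - phase m) / (Nfft%:R * (1 - phase 1))
  else if Ncp%:Z <= m <= Nfft%:Z + Ncp%:Z then
    (phase (m - Ncp%:Z) - 1) / (Nfft%:R * (1 - phase 1))
  else 0.

Section realization.
Variable Nt : nat.
Implicit Types (H : 'I_L -> 'cV[R[i]]_Nt) (u v : 'cV[R[i]]_Nt).

Definition twiddle (l p : nat) : R[i] :=
  expj (- (2 * pi * l%:R * p%:R / Nfft%:R)).

(* Bilinear: no conjugation. *)
Definition dotT u v : R[i] := (u^T *m v) 0 0.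

Definition vnorm u : R := Num.sqrt (\sum_k normc (u k 0) ^+ 2).

Definition hhat H (l : nat) : 'cV[R[i]]_Nt :=
  \sum_(p < L) twiddle l p *: H p.

Definition hhat_trunc (tau : nat) H (l : nat) : 'cV[R[i]]_Nt :=
  \sum_(p < L | (p < tau)%N) twiddle l p *: H p.

Definition hhat0_diag H (i : nat) : 'cV[R[i]]_Nt :=
  \sum_(m < L) ((c_weight m%:Z)%:C * twiddle i m) *: H m.

Definition hhat0 H (l i : nat) : 'cV[R[i]]_Nt :=
  \sum_(m < L | (Ncp <= m)%N) (ctilde l i m%:Z * twiddle l m) *: H m.

Definition precoder (tau : nat) H (l : nat) : 'cV[R[i]]_Nt :=
  ((vnorm (hhat_trunc tau H l))^-1)%:C *: map_mx conjc (hhat_trunc tau H l).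

Definition SINR H (w : 'I_Nsc -> 'cV[R[i]]_Nt) (snr : R) (i : 'I_Nsc) : R :=
  normc (dotT (hhat0_diag H i) (w i)) ^+ 2 /
  (normc (dotT (w i) (hhat H i - hhat0_diag H i)) ^+ 2
   + \sum_(l < Nsc | l != i) 2 * normc (dotT (hhat0 H l i) (w l)) ^+ 2
   + 1 / snr).

End realization.

Definition SINR_limit (tau : nat) (Ep : 'I_L -> R) (snr_op : R)
    (i : 'I_Nsc) : R :=
  (\sum_(p < L | (p < tau)%N) c_weight p%:Z * Ep p) ^+ 2 /
  (\sum_(l < Nsc)
      2 * normc (\sum_(p < L | (Ncp < p < tau)%N)
                   ctilde l i p%:Z * (Ep p)%:C) ^+ 2
   + (\sum_(p < L | (p < tau)%N) Ep p) * snr_op^-1).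

End ofdm.

(* Main.v *)
(** After dividing by N_t, every squared inner product in SINR_i is a
    quadratic form in the Gram averages N_t^-1 sum_k h_p[k] conj(h_q[k]), which
    converge almost surely to E_p if p = q and to 0 otherwise; the phases cancel
    in the limit because |e^{j theta}| = 1, and the factor 1/2 in the square of
    the diagonal weight (1 - c) / sqrt 2 cancels the factor 2 of the statement.

    Only second-moment tools are needed for the strong law. For orthogonal
    variables with bounded variance, Chebyshev-type summability gives convergence
    of the averages along n = N^2. Monotonicity of the partial sums fills the gaps
    when the summands are nonnegative; a product a b of independent components
    is reduced to that case through (a + b)^2 = a^2 + b^2 + 2 a b. *)

Require Import Defs.
From HB Require Import structures.
From mathcomp Require Import all_boot all_order all_algebra.
From mathcomp Require Import all_classical all_reals all_analysis.
From mathcomp Require Import finmap complex.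
From mathcomp Require Import measurable_realfun ring lra.

Set Implicit Arguments.
Unset Strict Implicit.
Unset Printing Implicit Defensive.

Import Order.TTheory GRing.Theory Num.Theory.
Import numFieldNormedType.Exports.
Import Normc.

Local Open Scope classical_set_scope.
Local Open Scope ring_scope.
Local Open Scope complex_scope.

(** * Gaussian moments *)

Section gaussian_moments.
Context (R : realType).
Notation mu := (@lebesgue_measure R).

(** The Radon-Nikodym derivative of [normal_prob m s] and the explicit density have the same
    integral over every measurable set, so they agree almost everywhere and may be exchanged under
    the integral. *)
Lemma ge0_integral_normal_prob (m s : R) (f : R -> \bar R) :
  measurable_fun setT f -> (forall x, 0 <= f x)%E ->
  (\int[normal_prob m s]_x f x = \int[mu]_x (f x * (normal_pdf m s x)%:E))%E.
Proof.
move=> mf f0; have dom := normal_prob_dominates m s.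
rewrite -(Radon_Nikodym_SigmaFinite.change_of_variables dom)//.
have mpdf : measurable_fun setT (fun x => (normal_pdf m s x)%:E).
  apply/measurable_EFinP. exact: measurable_normal_pdf.
have iRN := Radon_Nikodym_SigmaFinite.f_integrable dom.
apply: ae_eq_integral => //.
- by apply: emeasurable_funM => //; exact: (measurable_int mu iRN).
- exact: emeasurable_funM.
- apply: ae_eqe_mul2l; apply: integral_ae_eq => // A _ mA.
  by rewrite -Radon_Nikodym_SigmaFinite.f_integral.
Qed.

(** Dominated convergence reduces the integral to symmetric bounded intervals, where the fundamental
    theorem leaves only boundary values of [F]. This replaces integration by parts in the Gaussian
    moments. *)
Lemma integral_derivative_eq0 (f F : R -> R) :
  continuous f -> (forall x : R, is_derive x 1 F (f x)) ->
  mu.-integrable setT (EFin \o f) ->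
  F n%:R @[n --> \oo] --> (0 : R) -> F (- n%:R) @[n --> \oo] --> (0 : R) ->
  \int[mu]_x f x = 0.
Proof.
move=> cf dF fint Fp Fn.
have mf := measurable_int mu fint.
have {}dF x : derivable F x 1 /\ (F^`())%classic x = f x.
  by rewrite derive1E; case: (dF x).
(* The radius [n.+1] keeps every interval nondegenerate, as the fundamental theorem requires. *)
pose D (n : nat) : set R := `[- n.+1%:R, n.+1%:R]%classic.
pose g n := (EFin \o f) \_ (D n).
have [_ _ /=] : [/\ mu.-integrable setT (EFin \o f),
   [sequence \int[mu]_x `|g n x - (f x)%:E|]_n @ \oo --> 0 &
   [sequence \int[mu]_x g n x]_n @ \oo --> \int[mu]_x (f x)%:E]%E.
  apply: (@dominated_convergence _ _ _ mu setT measurableT g (EFin \o f)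
    (abse \o (EFin \o f))) => //.
  - move=> n; apply: (measurable_restrictT _ _).1; first exact: measurable_itv.
    exact: measurable_funTS.
  - apply: aeW => x _; apply: cvg_near_cst; near=> n.
    rewrite /g patchE ifT//; apply/mem_set; rewrite /D/= in_itv/= -ler_norml.
    near: n; exists (Num.truncn `|x|) => // n /= xn.
    by apply/ltW/(lt_le_trans (truncnS_gt _)); rewrite ler_nat.
  - exact: integrable_abse.
  - apply: aeW => x n _; rewrite /g patchE; case: ifP => // _.
    by rewrite abse0 abse_ge0.
have -> : (fun n => \int[mu]_x g n x)%E =
    (fun n => (F n.+1%:R - F (- n.+1%:R))%:E).
  apply/funext => n; rewrite /g -integral_mkcond.
  rewrite (@continuous_FTC2 _ f F)//.
  - by rewrite gtrN.
  - exact: continuous_subspaceT.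
  - have cF x : F @ x --> F x.
      exact/differentiable_continuous/derivable1_diffP/(dF x).1.
    split => //; [|exact: cvg_at_right_filter|exact: cvg_at_left_filter].
    by move=> x _; exact: (dF x).1.
  - by move=> x _; exact: (dF x).2.
have lim0 : (F n.+1%:R - F (- n.+1%:R))%:E @[n --> \oo] --> 0%E.
  apply: cvg_EFin; first exact: nearW.
  rewrite -[X in _ --> X](subr0 0); apply: cvgB.
    by rewrite (cvg_shiftS (fun n => F n%:R)).
  by rewrite (cvg_shiftS (fun n => F (- n%:R))).
move=> /(cvg_unique _ lim0) h; rewrite /Rintegral -h//.
Unshelve. all: by end_near. Qed.

Lemma integral_normal_prob (m s : R) (f : R -> R) :
  measurable_fun setT f ->
  mu.-integrable setT (fun x => (f x * normal_pdf m s x)%:E) ->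
  (normal_prob m s).-integrable setT (EFin \o f) /\
  \int[normal_prob m s]_x f x = \int[mu]_x (f x * normal_pdf m s x).
Proof.
move=> mf fint.
have mEf : measurable_fun setT (EFin \o f) by exact/measurable_EFinP.
have absE : (\int[normal_prob m s]_x `|(f x)%:E| =
             \int[mu]_x `|(f x * normal_pdf m s x)%:E|)%E.
  rewrite ge0_integral_normal_prob//; last exact: measurableT_comp.
  apply: eq_integral => x _; rewrite EFinM abseM; congr (_ * _)%E.
  by rewrite gee0_abs// lee_fin normal_pdf_ge0.
split; first by apply/integrableP; split=> //; rewrite absE; case/integrableP: fint.
rewrite /Rintegral [in LHS]integralE [in RHS]integralE.
rewrite !ge0_integral_normal_prob//;
  [|exact: measurable_funeneg|exact: measurable_funepos].
congr (fine (_ - _)); apply: eq_integral => x _.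
- rewrite !funeposE/= -!EFin_max -EFinM.
  by rewrite maxr_pMl ?normal_pdf_ge0// mul0r.
- rewrite !funenegE/= -!EFin_max -EFinM.
  by rewrite maxr_pMl ?normal_pdf_ge0// mul0r mulNr.
Qed.

(** Doubling the standard deviation frees a factor [expR (- y)] with [y = 3 x^2 / (8 s^2)], and
    [x^4 = (64/9) s^4 y^2] is absorbed through [y^2 <= 2 expR y]. The constant is
    [256/9 = (64/9) * 2 * 2], the last factor being the ratio of the two peaks. *)
Lemma quartic_gaussian_le (s x : R) : 0 < s ->
  x ^+ 4 * normal_pdf 0 s x <=
  (256 / 9) * s ^+ 4 * normal_pdf 0 (2 * s) x.
Proof.
move=> s0.
rewrite !normal_pdfE ?mulf_neq0 ?gt_eqF//.
rewrite /normal_peak /normal_fun subr0.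
have -> : Num.sqrt ((2 * s) ^+ 2 * pi *+ 2) = 2 * Num.sqrt (s ^+ 2 * pi *+ 2).
  rewrite exprMn -mulrA -mulrnAr sqrtrM ?exprn_ge0//.
  by rewrite sqrtr_sqr ger0_norm.
pose q : R := Num.sqrt (s ^+ 2 * pi *+ 2); rewrite -/q.
have q0 : 0 < q by rewrite sqrtr_gt0 mulrn_wgt0// mulr_gt0 ?pi_gt0 ?exprn_gt0.
clearbody q.
pose y := 3 * x ^+ 2 / (8 * s ^+ 2).
have y0 : 0 <= y by apply: divr_ge0; rewrite mulr_ge0 ?sqr_ge0.
have -> : - x ^+ 2 / (s ^+ 2 *+ 2) = - y - x ^+ 2 / ((2 * s) ^+ 2 *+ 2).
  rewrite /y; field; by rewrite gt_eqF.
rewrite expRD expRN mulNr.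
set G := expR (- (_ / _)); have G0 : 0 <= G by exact: expR_ge0.
have -> : x ^+ 4 = 64 / 9 * s ^+ 4 * y ^+ 2.
  rewrite /y; field; by rewrite gt_eqF.
have ye : y ^+ 2 / expR y <= 2.
  rewrite ler_pdivrMr ?expR_gt0//.
  by have := expR_ge1Dxn 1 y0; rewrite (_ : 2`!%:R = 2 :> R)//; lra.
have -> : 64 / 9 * s ^+ 4 * y ^+ 2 * (q^-1 * ((expR y)^-1 * G)) =
   (y ^+ 2 / expR y) * (64 / 9 * s ^+ 4 * (q^-1 * G)) by ring.
have -> : 256 / 9 * s ^+ 4 * ((2 * q)^-1 * G) = 2 * (64 / 9 * s ^+ 4 * (q^-1 * G)).
  by rewrite invfM; field; rewrite gt_eqF.

apply: ler_wpM2r => //; apply: mulr_ge0; apply: mulr_ge0;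
  by rewrite ?invr_ge0 ?exprn_ge0 ?(ltW s0) ?(ltW q0).
Qed.

Lemma cvg0_mulrn_bounded (u : nat -> R) (K : R) :
  (forall n, `|u n| * n%:R <= K) -> u n @[n --> \oo] --> (0 : R).
Proof.
move=> uK.
rewrite -(cvg_shiftS u); apply/norm_cvg0P.
apply: (@squeeze_cvgr _ _ _ _ (fun=> 0) (fun n => K * harmonic n)).
- apply: nearW => n; rewrite normr_ge0/= /harmonic/= ler_pdivlMr ?ltr0Sn//.
- exact: cvg_cst.
- rewrite -[X in _ --> X](mulr0 K); apply: cvgM; [exact: cvg_cst|exact: cvg_harmonic].
Qed.

Lemma is_derive_normal_pdf (s x : R) : s != 0 ->
  is_derive x 1 (normal_pdf 0 s) (- (x / s ^+ 2) * normal_pdf 0 s x).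
Proof.
move=> s0.
have -> : normal_pdf 0 s = normal_peak s *:
    (expR \o (- (2 * s ^+ 2)^-1 *: (id : R -> R) ^+ 2)) :> (R -> R).
  apply/funext => y; rewrite normal_pdfE//; congr (_ * expR _).
  by rewrite subr0 -[X in _ / X]mulr_natl mulNr mulrC -mulNr expr2.
apply: is_derive_eq.
pose k := normal_peak s; pose E := expR (- (2 * s ^+ 2)^-1 * x ^+ 2).
rewrite expr1 -[LHS]/(k * (E * (- (2 * s ^+ 2)^-1 * (2 * x * 1)))).
rewrite -[RHS]/(- (x / s ^+ 2) * (k * E)); clearbody k E.
by field.
Qed.

(** With [phi] the density, [x phi] is the derivative of [- s^2 phi], and [(x^2 - s^2) phi] is the
    derivative of [- s^2 x phi]. Both primitives vanish at infinity, so both integrals are zero. *)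
Lemma normal_prob_moments (s : R) : 0 < s ->
  [/\ (normal_prob 0 s).-integrable setT (fun x => (x ^+ 4)%:E),
      \int[normal_prob 0 s]_x x = 0 &
      \int[normal_prob 0 s]_x (x ^+ 2) = s ^+ 2].
Proof.
move=> s0; have sn0 : s != 0 by rewrite gt_eqF.
pose phi := normal_pdf 0 s.
have phi0 x : 0 <= phi x by exact: normal_pdf_ge0.
(* This single bound serves twice: for integrability against [phi], and for the decay of the
   primitives. *)
have [C C0 quartic] : exists2 C, 0 <= C &
    forall x, x ^+ 4 * phi x <= C * normal_pdf 0 (2 * s) x.
  exists (256 / 9 * s ^+ 4); first by rewrite mulr_ge0// exprn_ge0// ltW.
  by move=> x; exact: quartic_gaussian_le.
have intphi (f : R -> R) (a b : R) : measurable_fun setT f ->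
    (forall x, `|f x| <= a + b * x ^+ 4) -> 0 <= b ->
    mu.-integrable setT (fun x => (f x * phi x)%:E).
  move=> mf fle b0.
  have mp : measurable_fun setT phi by exact: measurable_normal_pdf.
  apply: (@le_integrable _ _ _ mu setT measurableT _
      ((fun x => a%:E * (normal_pdf 0 s x)%:E) \+
       (fun x => (b * C)%:E * (normal_pdf 0 (2 * s) x)%:E))%E).
  - by apply/measurable_EFinP; exact: measurable_funM.
  - move=> x _; rewrite /= lee_fin.
    apply: le_trans (ler_norm _); rewrite normrM (ger0_norm (phi0 x)).
    apply: (le_trans (ler_wpM2r (phi0 x) (fle x))).
    by rewrite mulrDl lerD2l -(mulrA b C) -(mulrA b (x ^+ 4)) ler_wpM2l.
  - by apply: integrableD => //; apply: integrableZl => //;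
      exact: integrable_normal_pdf.
have sq_le (x : R) : x ^+ 2 <= 1 + 1 * x ^+ 4.
  by have := sqr_ge0 (x ^+ 2 - 1); nra.
have int1 : mu.-integrable setT (fun x => (x * phi x)%:E).
  apply: (intphi id 2 1) => // x; have := sq_le x; have := sqr_ge0 (`|x| - 1).
  by rewrite -[x ^+ 2]real_normK ?num_real//; nra.
have int2 : mu.-integrable setT (fun x => (x ^+ 2 * phi x)%:E).
  apply: (intphi (fun x => x ^+ 2) 1 1) => //.
  by move=> x; rewrite ger0_norm ?sqr_ge0.
have int4 : mu.-integrable setT (fun x => (x ^+ 4 * phi x)%:E).
  apply: (intphi (fun x => x ^+ 4) 0 1) => //.
  by move=> x; rewrite ger0_norm ?exprn_even_ge0// add0r mul1r.
have int0 : mu.-integrable setT (fun x => (phi x)%:E).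
  exact: integrable_normal_pdf.
have int0s : mu.-integrable setT (fun x => (s ^+ 2 * phi x)%:E).
  by under eq_fun do rewrite EFinM; exact: integrableZl.
have dphi := is_derive_normal_pdf _ sn0.
have [_ ->] := integral_normal_prob (@measurable_id _ R setT) int1.
have [_ ->] := integral_normal_prob (@exprn_measurable R setT 2) int2.
have [-> _] := integral_normal_prob (@exprn_measurable R setT 4) int4.
(* For [|x| >= 1] and [k <= 1] the power [|x|^(k+1)] is at most [x^4], and a density is at most its
   peak. *)
have decay k (x : R) : (k <= 1)%N -> 1 <= `|x| ->
    `|x ^+ k * phi x| * `|x| <= C * normal_peak (2 * s).
  move=> k1 x1; rewrite normrM (ger0_norm (phi0 x)) normrX.
  apply: (@le_trans _ _ (x ^+ 4 * phi x)).
    rewrite mulrAC ler_wpM2r// -exprSr -[x ^+ 4]ger0_norm ?exprn_even_ge0//.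
    by rewrite normrX ler_weXn2l//; exact: (leq_ltn_trans k1).
  apply: (le_trans (quartic x)); rewrite ler_wpM2l//.
  by rewrite normal_pdf_ub// mulf_neq0.
(* The sign [e] covers both ends of the line; [k = 0] and [k = 1] are the primitives for the first
   and second moment. *)
have lim k (e : R) : (k <= 1)%N -> `|e| = 1 ->
    (- s ^+ 2 * ((e * n%:R) ^+ k * phi (e * n%:R))) @[n --> \oo] --> (0 : R).
  move=> k1 e1; apply: (@cvg0_mulrn_bounded _ (s ^+ 2 * (C * normal_peak (2 * s)))).
  case=> [|n].
    by rewrite mulr0 mulr_ge0 ?sqr_ge0// mulr_ge0// normal_peak_ge0.
  rewrite /= normrM normrN (ger0_norm (sqr_ge0 s)) -mulrA.
  apply: ler_wpM2l; rewrite ?sqr_ge0//.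
  have {3}-> : n.+1%:R = `|e * n.+1%:R| :> R by rewrite normrM e1 mul1r ger0_norm.
  by apply: decay => //; rewrite normrM e1 mul1r ger0_norm// ler1n.
split => //.
- apply: (@integral_derivative_eq0 _ (fun x => - s ^+ 2 * phi x)) => //.
  + by move=> x; apply: cvgM; [exact: cvg_id|exact: continuous_normal_pdf].
  + move=> x; rewrite (_ : (fun x => _) = - s ^+ 2 *: phi :> (R -> R))//.
    by apply: is_derive_eq; rewrite /GRing.scale/=; field.
  + by have := lim 0 1 isT (normr1 _); under eq_fun do rewrite expr0 !mul1r.
  + have := lim 0 (-1) isT (normrN1 _).
    by under eq_fun do rewrite expr0 !mul1r mulN1r.
- apply/eqP; rewrite -subr_eq0; apply/eqP.
  have -> : s ^+ 2 = \int[mu]_x (s ^+ 2 * phi x).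
    rewrite RintegralZl//.
    by rewrite /Rintegral integral_normal_pdf mulr1.
  rewrite -RintegralB//.
  apply: (@integral_derivative_eq0 _ (fun x => - s ^+ 2 * (x * phi x))) => //.
  + move=> x; apply: cvgB.
      by apply: cvgM; [exact: exprn_continuous|exact: continuous_normal_pdf].
    by apply: cvgM; [exact: cvg_cst|exact: continuous_normal_pdf].
  + move=> x.
    rewrite (_ : (fun x => _) = - s ^+ 2 *: ((id : R -> R) * phi) :> (R -> R))//.
    by apply: is_derive_eq; rewrite /GRing.scale/=; field.
  + exact: (integrableB measurableT int2 int0s).
  + by have := lim 1 1 isT (normr1 _); under eq_fun do rewrite expr1 !mul1r.
  + have := lim 1 (-1) isT (normrN1 _).
    by under eq_fun do rewrite expr1 !mulN1r.
Qed.

End gaussian_moments.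

(** * Laws and independence *)

Section independent_integrals.
Context d (T : measurableType d) (R : realType) (P : probability T R).

Lemma integral_law (m : {measure set (measurableTypeR R) -> \bar R})
    (X : T -> measurableTypeR R) (f : measurableTypeR R -> R) :
  measurable_fun setT X -> measurable_fun setT f ->
  (forall A, measurable A -> P (X @^-1` A) = m A) ->
  m.-integrable setT (EFin \o f) ->
  P.-integrable setT (fun t => (f (X t))%:E) /\
  \int[P]_t f (X t) = \int[m]_x f x.
Proof.
move=> mX mf lawX intf.
have mEf : measurable_fun setT (EFin \o f) by exact/measurable_EFinP.
have intfX : P.-integrable setT ((EFin \o f) \o X).
  apply/integrableP; split; first exact: measurableT_comp.
  have -> : (\int[P]_x `|((EFin \o f) \o X) x| = \int[pushforward P X]_x `|(f x)%:E|)%E.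
    by rewrite ge0_integral_pushforward//; exact: measurableT_comp.
  rewrite (eq_measure_integral m); last by move=> A mA _; exact: lawX.
  by case/integrableP : intf.
split => //; rewrite /Rintegral; congr fine.
have := @integral_pushforward _ _ _ _ _ _ mX P setT (EFin \o f) mEf.
rewrite preimage_setT => /(_ intfX measurableT) <-.
by apply: eq_measure_integral => A mA _; exact: lawX.
Qed.

(** The fourth moment [K] is chosen before [X], so that one constant serves all the entries of a
    tap. *)
Lemma centered_normal_moments (v : R) : 0 <= v -> exists K, forall X : T -> R,
  measurable_fun setT X ->
  (forall A, measurable A -> P (X @^-1` A) = centered_normal v A) ->
  [/\ P.-integrable setT (fun t => (X t ^+ 4)%:E), \int[P]_t (X t ^+ 4) = K,
      \int[P]_t X t = 0 & \int[P]_t (X t ^+ 2) = v].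
Proof.
have mexp n : measurable_fun setT ((fun x => x ^+ n) : measurableTypeR R -> R).
  exact: exprn_measurable.
rewrite le_eqVlt => v0.
(* The set function [centered_normal v] is replaced by a genuine measure: a point mass for [v = 0],
   a normal law otherwise. *)
have [m [mE m4 m1 m2]] : exists m : {finite_measure set (measurableTypeR R) -> \bar R},
    [/\ forall A, measurable A -> centered_normal v A = m A,
        m.-integrable setT (fun x => (x ^+ 4)%:E),
        \int[m]_x x = 0 & \int[m]_x (x ^+ 2) = v].
  have [v_eq0|vn0] := eqVneq v 0.
    exists (dirac (0 : measurableTypeR R)); split.
    - by move=> A _; rewrite /centered_normal v_eq0 eqxx.
    - apply/integrableP; split.
        by apply/measurable_EFinP; exact: mexp.
      rewrite integral_dirac ?diracT//=; first by rewrite mul1e ltry.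
      by apply/measurable_EFinP; apply: measurableT_comp => //; exact: mexp.
    - by rewrite /Rintegral integral_dirac// diracT mul1e.
    - rewrite /Rintegral integral_dirac//.
        by rewrite diracT mul1e expr0n/= v_eq0.
      by apply/measurable_EFinP; exact: mexp.
  have v_gt0 : 0 < v by move: v0; rewrite eq_sym (negbTE vn0).
  have [m4 m1 m2] := @normal_prob_moments R (Num.sqrt v) ltac:(by rewrite sqrtr_gt0).
  exists (normal_prob 0 (Num.sqrt v)); split => //.
  - by move=> A _; rewrite /centered_normal (negbTE vn0).
  - by rewrite m2 sqr_sqrtr// ltW.
exists (\int[m]_x (x ^+ 4)) => X mX lawX.
have lawm A : measurable A -> P (X @^-1` A) = m A.
  by move=> mA; rewrite lawX// mE.
have int_le (f : R -> R) : measurable_fun setT f ->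
    (forall x, `|f x| <= 2 + x ^+ 4) -> m.-integrable setT (EFin \o f).
  move=> mf fle.
  apply: (@le_integrable _ _ _ m setT measurableT _
      (cst 2%:E \+ (fun x => (x ^+ 4)%:E))%E).
  - exact/measurable_EFinP.
  - move=> x _ /=; rewrite lee_fin; apply: le_trans (ler_norm _); exact: fle.
  - by apply: integrableD => //; exact: finite_measure_integrable_cst.
have [i4 e4] := integral_law mX (mexp 4) lawm m4.
have sq_le (x : R) : x ^+ 2 <= 1 + x ^+ 4.
  by have := sqr_ge0 (x ^+ 2 - 1); nra.
have [|_ i1] := integral_law mX (@measurable_id _ (measurableTypeR R) setT) lawm.
  apply: int_le => // x; have := sq_le x; have := sqr_ge0 (`|x| - 1).
  by rewrite -[x ^+ 2]real_normK ?num_real//; nra.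
have [|_ i2] := integral_law mX (mexp 2) lawm.
  apply: int_le; first exact: mexp.
  by move=> x; rewrite ger0_norm ?sqr_ge0//; have := sq_le x; lra.
by split => //; rewrite ?i1 ?i2.
Qed.

Definition independent2 (X Y : T -> R) :=
  forall A B, measurable A -> measurable B ->
    (P (X @^-1` A `&` Y @^-1` B) = P (X @^-1` A) * P (Y @^-1` B))%E.

(** Independence fixes the joint law on rectangles, hence it is the product of the two laws. Tonelli
    gives integrability of the product, and Fubini factors the integral. *)
Lemma independent2_integralM (X Y : T -> R) :
  measurable_fun setT X -> measurable_fun setT Y ->
  P.-integrable setT (EFin \o X) -> P.-integrable setT (EFin \o Y) ->
  independent2 X Y ->
  P.-integrable setT (fun t => (X t * Y t)%:E) /\
  \int[P]_t (X t * Y t) = \int[P]_t X t * \int[P]_t Y t.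
Proof.
move=> mX mY iX iY indXY.
pose X' : {mfun T >-> R} := MeasurableFun.Pack
  (MeasurableFun.Class (isMeasurableFun.Build _ _ _ _ _ mX)).
pose Y' : {mfun T >-> R} := MeasurableFun.Pack
  (MeasurableFun.Class (isMeasurableFun.Build _ _ _ _ _ mY)).
pose m1 := distribution P X'; pose m2 := distribution P Y'.
have mZ : measurable_fun setT (fun t => (X t, Y t)) by exact: measurable_fun_pair.
pose Z' : {mfun T >-> (R * R)%type} := MeasurableFun.Pack
  (MeasurableFun.Class (isMeasurableFun.Build _ _ _ _ _ mZ)).
have jointE A : measurable A -> distribution P Z' A = (m1 \x m2)%E A.
  move=> mA; apply/esym.
  by apply: (@product_measure_unique _ _ _ _ _ m1 m2 (distribution P Z')).
pose f (z : R * R) : \bar R := (z.1 * z.2)%:E.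
have mf : measurable_fun setT f.
  apply/measurable_EFinP.
  by apply: measurable_funM; [exact: measurable_fst|exact: measurable_snd].
have intE (g : {mfun T >-> R}) :
    (\int[distribution P g]_y `|y%:E| = \int[P]_t `|(g t)%:E|)%E.
  by rewrite ge0_integral_distribution//; exact: measurableT_comp.
have iXoo : (\int[m1]_y `|y%:E| < +oo)%E by rewrite (intE X'); case/integrableP: iX.
have iYoo : (\int[m2]_y `|y%:E| < +oo)%E by rewrite (intE Y'); case/integrableP: iY.
have if12 : (m1 \x m2)%E.-integrable setT f.
  apply/integrable12ltyP => //.
  have -> : (\int[m1]_x \int[m2]_y `|f (x, y)| =
      \int[m1]_x (`|x%:E| * \int[m2]_y `|y%:E|))%E.
    apply: eq_integral => x _; rewrite -ge0_integralZl//; last exact: measurableT_comp.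
    by apply: eq_integral => y _; rewrite /f EFinM abseM.
  rewrite ge0_integralZr//; [|exact: measurableT_comp|exact: integral_ge0].
  apply: lte_mul_pinfty => //; first exact: integral_ge0.
  by rewrite ge0_fin_numE// integral_ge0.
have iXY : P.-integrable setT (fun t => (X t * Y t)%:E).
  apply/integrableP; split; first by apply/measurable_EFinP; exact: measurable_funM.
  have -> : (\int[P]_t `|(X t * Y t)%:E| = \int[distribution P Z']_z `|f z|)%E.
    by rewrite ge0_integral_distribution//; exact: measurableT_comp.
  rewrite (eq_measure_integral (m1 \x m2)%E); last by move=> A mA _; exact: jointE.
  by case/integrableP : if12.
have E1 (g : {mfun T >-> R}) : P.-integrable setT (EFin \o g) ->
    (\int[distribution P g]_y y%:E = \int[P]_t (g t)%:E)%E.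
  by move=> ig; rewrite integral_distribution.
split => //.
rewrite /Rintegral -fineM; try exact: integrable_fin_num.
congr fine.
transitivity (\int[distribution P Z']_z f z)%E.
  by rewrite integral_distribution.
rewrite (eq_measure_integral (m1 \x m2)%E); last by move=> A mA _; exact: jointE.
rewrite -integral12_prod_meas1// /fubini_F.
rewrite -(E1 X')// -(E1 Y')//.
have i1 : m1.-integrable setT (fun x => x%:E).
  by apply/integrableP; split; [exact/measurable_EFinP|exact: iXoo].
have i2 : m2.-integrable setT (fun x => x%:E).
  by apply/integrableP; split; [exact/measurable_EFinP|exact: iYoo].
have f2 : (\int[m2]_y y%:E)%E \is a fin_num by exact: integrable_fin_num.
rewrite -(fineK f2) -integralZr//.
apply: eq_integral => x _; rewrite fineK// -integralZl//.
Qed.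

End independent_integrals.

(** * Averages of orthogonal variables *)

Section strong_law.
Context d (T : measurableType d) (R : realType) (P : probability T R).

Lemma Rintegral_sum (I : Type) (s : seq I) (f : I -> T -> R) :
  (forall i, P.-integrable setT (EFin \o f i)) ->
  P.-integrable setT (fun t => (\sum_(i <- s) f i t)%:E) /\
  \int[P]_t (\sum_(i <- s) f i t) = \sum_(i <- s) \int[P]_t f i t.
Proof.
move=> intf; elim: s => [|i s [IHi IHe]].
  under eq_fun do rewrite big_nil; split; first exact: integrable0.
  rewrite big_nil; under eq_Rintegral do rewrite big_nil.
  by rewrite Rintegral_cst// mul0r.
have E : (fun t => (\sum_(j <- i :: s) f j t)) = (fun t => f i t + \sum_(j <- s) f j t).
  by apply/funext => t; rewrite big_cons.
split.
  rewrite (_ : (fun t => _) = (EFin \o f i) \+ (fun t => (\sum_(j <- s) f j t)%:E))%E.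
    exact: integrableD.
  by apply/funext => t; rewrite big_cons.
by rewrite E RintegralD// big_cons IHe.
Qed.

(** Induction needs the sharper bound [2 - 1 / (m + 1)], which telescopes because
    [1 / (x + 1)^2 <= 1 / x - 1 / (x + 1)]. *)
Lemma sum_inv_sqr_le2 (n : nat) : \sum_(k < n) (k.+1%:R ^+ 2)^-1 <= 2 :> R.
Proof.
suff H m : \sum_(k < m.+1) (k.+1%:R ^+ 2)^-1 <= 2 - m.+1%:R^-1 :> R.
  apply: (@le_trans _ _ (\sum_(k < n.+1) (k.+1%:R ^+ 2)^-1)).
    by rewrite big_ord_recr/= lerDl invr_ge0 exprn_ge0.
  by apply: le_trans (H n) _; rewrite gerBl invr_ge0.
elim: m => [|m IH]; first by rewrite big_ord_recr big_ord0/= add0r expr1n invr1; lra.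
rewrite big_ord_recr/=; apply: (le_trans (lerD IH (lexx _))).
have p : 0 < m.+1%:R :> R by rewrite ltr0n.
have -> : m.+2%:R = m.+1%:R + 1 :> R by rewrite -natr1.
move: (m.+1%:R : R) p => x p.
have -> : x^-1 = (x + 1)^-1 + (x * (x + 1))^-1 by field; apply/andP; split; lra.
suff : (x + 1) ^- 2 <= (x * (x + 1))^-1 by lra.
rewrite lef_pV2 ?posrE ?mulr_gt0 ?exprn_gt0//; nra.
Qed.

Lemma nneseries_lty_cvg0 (x : nat -> R) : (forall n, 0 <= x n) ->
  (\sum_(0 <= n <oo) (x n)%:E < +oo)%E -> x n @[n --> \oo] --> (0 : R).
Proof.
move=> x0 xoo; apply: cvg_series_cvg_0.
have xge n : (0 <= \sum_(0 <= k < n) (x k)%:E)%E.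
  by apply: sume_ge0 => k _; rewrite lee_fin.
have fin : (\sum_(0 <= n <oo) (x n)%:E)%E \is a fin_num.
  rewrite ge0_fin_numE//; apply: nneseries_ge0 => n _ _; by rewrite lee_fin.
apply: nondecreasing_is_cvgn.
  by apply/nondecreasing_seqP => n; rewrite /series/= big_nat_recr//= lerDl.
exists (fine (\sum_(0 <= n <oo) (x n)%:E)%E) => _ [n _ <-].
rewrite -lee_fin fineK// /series/= -sumEFin.
by apply: nneseries_lim_ge => k _ _; rewrite lee_fin.
Qed.

(* Since [sum_n E (S_(n^2) / n^2)^2 <= sum_n C / n^2] is finite, the series of
   squares converges almost surely. *)
Lemma orthogonal_sqr_average_cvg0 (Y : nat -> T -> R) (C : R) :
  (forall k j, P.-integrable setT (fun t => (Y k t * Y j t)%:E)) ->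
  (forall k, measurable_fun setT (Y k)) ->
  (forall k j, k != j -> \int[P]_t (Y k t * Y j t) = 0) ->
  (forall k, \int[P]_t (Y k t * Y k t) <= C) ->
  {ae P, forall t, (\sum_(k < n.+1 ^ 2) Y k t) / (n.+1 ^ 2)%:R @[n --> \oo] --> (0 : R)}.
Proof.
move=> iY mY Y0 YC.
have sqE n t : (\sum_(k < n) Y k t) ^+ 2 =
    \sum_(z : 'I_n * 'I_n) (Y z.1 t * Y z.2 t).
  by rewrite expr2 big_distrlr/= pair_bigA.
(* Orthogonality removes the cross terms, so the second moment grows only linearly in [n]. *)
have isq n : P.-integrable setT (fun t => ((\sum_(k < n) Y k t) ^+ 2)%:E) /\
    \int[P]_t ((\sum_(k < n) Y k t) ^+ 2) <= C * n%:R.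
  have [i1 e1] := Rintegral_sum (index_enum ('I_n * 'I_n)%type)
    (fun z : 'I_n * 'I_n => iY z.1 z.2).
  split; first by under eq_fun do rewrite sqE.
  under eq_Rintegral do rewrite sqE.
  rewrite e1.
  rewrite -(pair_bigA _ (fun k j : 'I_n => \int[P]_t (Y k t * Y j t)))/=.
  rewrite -[n in _ * n%:R]card_ord mulr_natr -sumr_const.
  apply: ler_sum => k _; rewrite (bigD1 k)//= big1 ?addr0// => j jk.
  by apply: Y0; rewrite eq_sym.
pose X n t := ((\sum_(k < n.+1 ^ 2) Y k t) / (n.+1 ^ 2)%:R) ^+ 2.
have X0 n t : 0 <= X n t by exact: sqr_ge0.
have mX n : measurable_fun setT (X n).
  apply: measurable_funX; apply: measurable_funM => //.
  by apply: measurable_sum => k; exact: mY.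
have intX n : (\int[P]_t (X n t)%:E <= (C * (n.+1%:R ^+ 2)^-1)%:E)%E.
  have [i1 i2] := isq (n.+1 ^ 2)%N.
  have -> : (fun t => (X n t)%:E) = (fun t => (((n.+1 ^ 2)%:R ^+ 2)^-1)%:E *
      ((\sum_(k < n.+1 ^ 2) Y k t) ^+ 2)%:E)%E.
    by apply/funext => t; rewrite -EFinM /X expr_div_n mulrC.
  rewrite integralZl// -[X in (_ * X)%E]fineK; last exact: integrable_fin_num.
  rewrite -EFinM lee_fin; apply: le_trans (ler_wpM2l _ i2) _.
    by rewrite invr_ge0 sqr_ge0.
  have -> : ((n.+1 ^ 2)%:R ^+ 2)^-1 * (C * (n.+1 ^ 2)%:R) = C * (n.+1%:R ^+ 2)^-1.
    have q0 : n.+1%:R != 0 :> R by rewrite pnatr_eq0.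
    by rewrite natrX; move: (n.+1%:R : R) q0 => q q0; field.
  by [].
have C0 : 0 <= C.
  apply: le_trans (YC 0); apply: Rintegral_ge0 => t _.
  by rewrite -expr2 sqr_ge0.
have sumX : (\int[P]_t (\sum_(0 <= n <oo) (X n t)%:E) < +oo)%E.
  rewrite integral_nneseries//; last 2 first.
  - by move=> n; apply/measurable_EFinP.
  - by move=> n t _; rewrite lee_fin.
  apply: (@le_lt_trans _ _ (C * 2)%:E); last exact: ltry.
  apply: lime_le.
    by apply: is_cvg_nneseries => n _ _; apply: integral_ge0 => t _; rewrite lee_fin.
  apply: nearW => n; rewrite big_mkord.
  apply: (@le_trans _ _ (\sum_(k < n) (C * (k.+1%:R ^+ 2)^-1)%:E)%E).
    by apply: lee_sum => k _; exact: intX.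
  by rewrite sumEFin lee_fin -mulr_sumr ler_wpM2l// sum_inv_sqr_le2.
have sX0 t : (0 <= \sum_(0 <= n <oo) (X n t)%:E)%E.
  by apply: nneseries_ge0 => n _ _; rewrite lee_fin.
have isX : P.-integrable setT (fun t => \sum_(0 <= n <oo) (X n t)%:E)%E.
  apply/integrableP; split.
    apply: ge0_emeasurable_sum => [n t _ _|n _]; first by rewrite lee_fin.
    exact/measurable_EFinP.
  by under eq_integral do rewrite gee0_abs//.
have := integrable_ae measurableT isX.
apply: filterS => t /(_ I); rewrite ge0_fin_numE// => /(nneseries_lty_cvg0 (X0^~ t)) Xt.
apply/norm_cvg0P.
have : Num.sqrt (X n t) @[n --> \oo] --> (0 : R).
  by rewrite -(@sqrtr0 R); apply: continuous_cvg => //; exact: sqrt_continuous.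
by under eq_fun do rewrite sqrtr_sqr.
Qed.

(** For [(n+1)^2 <= k <= (n+2)^2], monotonicity squeezes [W k / k] between [W ((n+1)^2) / (n+2)^2]
    and [W ((n+2)^2) / (n+1)^2]. Both tend to [m], since the ratio of consecutive squares tends to
    1. *)
Lemma average_cvg_of_sqr (w : nat -> R) (m : R) : (forall k, 0 <= w k) ->
  (\sum_(k < n.+1 ^ 2) w k) / (n.+1 ^ 2)%:R @[n --> \oo] --> m ->
  (\sum_(k < n) w k) / n%:R @[n --> \oo] --> m.
Proof.
move=> w0 wm; pose W n := \sum_(k < n) w k.
have Wmono a b : (a <= b)%N -> W a <= W b.
  move=> ab; rewrite /W -(subnKC ab) big_split_ord/= lerDl.
  by apply: sumr_ge0.
have W0 a : 0 <= W a by apply: sumr_ge0.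
have ratio : (n.+1%:R / n.+2%:R : R) @[n --> \oo] --> (1 : R).
  have -> : (fun n => n.+1%:R / n.+2%:R : R) = (fun n => 1 - harmonic n.+1).
    apply/funext => n; rewrite /harmonic/=.
    have -> : n.+2%:R = n.+1%:R + 1 :> R by rewrite -natr1.
    have p : 0 < n.+1%:R :> R by rewrite ltr0n.
    by field; lra.
  rewrite -[X in _ --> X]subr0; apply: cvgB; first exact: cvg_cst.
  by rewrite (cvg_shiftS (@harmonic R : nat -> R)); exact: cvg_harmonic.
have lo : (W (n.+1 ^ 2)%N / (n.+2 ^ 2)%:R) @[n --> \oo] --> m.
  have -> : (fun n => W (n.+1 ^ 2)%N / (n.+2 ^ 2)%:R) =
      (fun n => (W (n.+1 ^ 2)%N / (n.+1 ^ 2)%:R) * (n.+1%:R / n.+2%:R) ^+ 2).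
    apply/funext => n; rewrite !natrX.
    have : n.+2%:R != 0 :> R by rewrite pnatr_eq0.
    have : n.+1%:R != 0 :> R by rewrite pnatr_eq0.
    by move: (n.+1%:R : R) (n.+2%:R : R) => q r q0 r0; field; rewrite ?q0 ?r0.
  rewrite -[X in _ --> X]mulr1; apply: cvgM => //.
  by rewrite -[X in _ --> X](mulr1 1); under eq_fun do rewrite expr2; exact: cvgM.
have hi : (W (n.+2 ^ 2)%N / (n.+1 ^ 2)%:R) @[n --> \oo] --> m.
  have -> : (fun n => W (n.+2 ^ 2)%N / (n.+1 ^ 2)%:R) =
      (fun n => (W (n.+2 ^ 2)%N / (n.+2 ^ 2)%:R) * ((n.+1%:R / n.+2%:R)^-1) ^+ 2).
    apply/funext => n; rewrite !natrX.
    have : n.+2%:R != 0 :> R by rewrite pnatr_eq0.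
    have : n.+1%:R != 0 :> R by rewrite pnatr_eq0.
    by move: (n.+1%:R : R) (n.+2%:R : R) => q r q0 r0; field; rewrite ?q0 ?r0.
  rewrite -[X in _ --> X]mulr1; apply: cvgM.
    by rewrite (cvg_shiftS (fun n => W (n.+1 ^ 2)%N / (n.+1 ^ 2)%:R)).
  have ratioV : ((n.+1%:R / n.+2%:R)^-1 : R) @[n --> \oo] --> (1 : R).
    by rewrite -[X in _ --> X]invr1; exact: (cvgV (oner_neq0 R) ratio).
  by rewrite -[X in _ --> X](mulr1 1); under eq_fun do rewrite expr2; exact: cvgM.
apply/cvgrPdist_le => e e0.
move/cvgrPdist_le : lo => /(_ _ e0) [N1 _ lo].
move/cvgrPdist_le : hi => /(_ _ e0) [N2 _ hi].
exists ((N1 + N2).+1 ^ 2)%N => // k /= Nk.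
(* Here [n.+1] is the largest integer whose square is at most [k]; the threshold on [k] makes it
   exceed [N1 + N2]. *)
have [n [Nn nk kn]] : exists n,
    [/\ (N1 + N2 <= n)%N, (n.+1 ^ 2 <= k)%N & (k <= n.+2 ^ 2)%N].
  have ex : exists n, (n ^ 2 <= k)%N by exists 0%N.
  have bd n : (n ^ 2 <= k)%N -> (n <= k)%N.
    by apply: leq_trans; case: n => // n; rewrite expnS expn1 leq_pmulr.
  case: (ex_maxnP ex bd) => n nk nmax.
  have Nn : ((N1 + N2).+1 <= n)%N by exact: nmax.
  case: n nk nmax Nn => // n nk nmax Nn; exists n; split => //.
  by rewrite leqNgt; apply/negP => /ltnW /nmax; rewrite ltnn.
have k0 : (0 < k)%N by apply: leq_trans nk; rewrite expn_gt0.
have := lo n (leq_trans (leq_addr _ _) Nn); have := hi n (leq_trans (leq_addl _ _) Nn).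
rewrite -/(W k) /= !ler_norml => /andP[h1 h2] /andP[l1 l2].
have kp : 0 < k%:R :> R by rewrite ltr0n.
have np j : 0 < (j.+1 ^ 2)%:R :> R by rewrite ltr0n expn_gt0.
have le1 : W (n.+1 ^ 2)%N / (n.+2 ^ 2)%:R <= W k / k%:R.
  apply: ler_pM; rewrite ?W0 ?invr_ge0 ?Wmono ?ler0n//.
  by rewrite lef_pV2 ?posrE// ler_nat.
have le2 : W k / k%:R <= W (n.+2 ^ 2)%N / (n.+1 ^ 2)%:R.
  apply: ler_pM; rewrite ?W0 ?invr_ge0 ?Wmono ?ler0n//.
  by rewrite lef_pV2 ?posrE// ler_nat.
move: le1 le2 h1 h2 l1 l2; move: (_ / (n.+2 ^ 2)%:R) (_ / (n.+1 ^ 2)%:R) (_ / k%:R).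
by move=> x y z *; apply/andP; split; lra.
Qed.

End strong_law.

(** * Averages of products of two sequences *)

Section average_products.
Context (R : realType).

Lemma average_cvg_sqr (u : nat -> R) (m : R) :
  (\sum_(k < n) u k) / n%:R @[n --> \oo] --> m ->
  (\sum_(k < n.+1 ^ 2) u k) / (n.+1 ^ 2)%:R @[n --> \oo] --> m.
Proof.
apply: (@cvg_comp _ _ _ (fun n => (n.+1 ^ 2)%N) (fun n => (\sum_(k < n) u k) / n%:R)).
move=> A [N _ NA]; exists N => // n /= Nn; apply: NA => /=.
by rewrite (leq_trans Nn)// (leq_trans (leqnSn n))// expnS expn1 leq_pmulr.
Qed.

(* [(a + b)^2 >= 0], so its averages are controlled by those along the squares. *)
Lemma average_mul_cvg (a b : nat -> R) (sa sb : R) :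
  (\sum_(k < n) a k ^+ 2) / n%:R @[n --> \oo] --> sa ->
  (\sum_(k < n) b k ^+ 2) / n%:R @[n --> \oo] --> sb ->
  (\sum_(k < n.+1 ^ 2) a k * b k) / (n.+1 ^ 2)%:R @[n --> \oo] --> (0 : R) ->
  (\sum_(k < n) a k * b k) / n%:R @[n --> \oo] --> (0 : R).
Proof.
move=> ca cb cab.
have sqE n : (\sum_(k < n) (a k + b k) ^+ 2) / n%:R =
    (\sum_(k < n) a k ^+ 2) / n%:R + (\sum_(k < n) b k ^+ 2) / n%:R
    + 2 * ((\sum_(k < n) a k * b k) / n%:R).
  rewrite mulrA mulr_sumr -!mulrDl -!big_split/=; congr (_ / _).
  by apply: eq_bigr => k _; rewrite sqrrD -mulr_natl; ring.
have c2 : (\sum_(k < n) (a k + b k) ^+ 2) / n%:R @[n --> \oo] --> sa + sb.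
  apply: (@average_cvg_of_sqr _ (fun k => (a k + b k) ^+ 2)) => [k|].
    exact: sqr_ge0.
  have ca' := @average_cvg_sqr (fun k => a k ^+ 2) _ ca.
  have cb' := @average_cvg_sqr (fun k => b k ^+ 2) _ cb.
  have := cvgD (cvgD ca' cb') (cvgM (cvg_cst (2 : R)) cab).
  rewrite mulr0 addr0 => c.
  by under eq_fun do rewrite sqE; exact: c.
have -> : (fun n => (\sum_(k < n) a k * b k) / n%:R) =
    (fun n => 2^-1 * ((\sum_(k < n) (a k + b k) ^+ 2) / n%:R -
      ((\sum_(k < n) a k ^+ 2) / n%:R + (\sum_(k < n) b k ^+ 2) / n%:R))).
  by apply/funext => n; rewrite sqE addrAC subrr add0r mulKf.
by have := cvgM (cvg_cst (2^-1 : R)) (cvgB c2 (cvgD ca cb)); rewrite subrr mulr0; exact.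
Qed.

End average_products.

(** * Averages of channel taps *)

Section tap_averages.
Context d (T : measurableType d) (R : realType) (P : probability T R).

Lemma Rintegral_probability_cst (c : R) : \int[P]_t c = c.
Proof. by rewrite /Rintegral; have := expectation_cst P c; rewrite unlock => ->. Qed.

Lemma mutually_independent_pair (I : choiceType) (F : I -> set_system T) (i j : I)
    (A B : set T) :
  mutually_independent P F -> i != j -> F i A -> F j B ->
  (P (A `&` B) = P A * P B)%E.
Proof.
move=> indF ij FA FB.
have := indF [fset i; j]%fset (fun k => if k == i then A else B) _.
have ji : (j == i) = false by rewrite eq_sym (negbTE ij).
rewrite big_fsetU1/= ?inE// big_seq_fset1 eqxx ji => <-.
  congr (P _); apply/seteqP; split => [t [At Bt] k /=|t H].
    by case: ifP.
  split.
    by have := H i; rewrite /= !inE eqxx; apply.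
  by have := H j; rewrite /= !inE eqxx orbT ji; apply.
by move=> k; rewrite !inE => /orP[]/eqP->; rewrite ?eqxx ?ji.
Qed.

(** A boolean selects the coordinate, so that real and imaginary parts share one proof. *)
Definition part (b : bool) (z : R[i]) : R :=
  if b then complex.Re z else complex.Im z.

Lemma sigma_of_part (Z : T -> R[i]) (b : bool) (A : set R) : measurable A ->
  sigma_of Z ((fun t => part b (Z t)) @^-1` A).
Proof.
move=> mA; case: b.
  exists (A `*` setT); first exact: measurableX.
  by rewrite setTI; apply/seteqP; split => t //= -[].
exists (setT `*` A); first exact: measurableX.
by rewrite setTI; apply/seteqP; split => t //= -[].
Qed.

(** Measurability is relative to the sigma-algebra of the whole tap sequence, so that a product of
    two entries of one tap stays in it and independence between taps applies to such products. *)
Lemma measurable_part_seq (Z : nat -> T -> R[i]) (b : bool) (k : nat) :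
  measurable_fun setT ((fun t => part b (Z k t)) :
    g_sigma_algebraType (\bigcup_k sigma_of (Z k)) -> R).
Proof.
move=> _ A mA; rewrite setTI; apply: sub_sigma_algebra.
by exists k => //; exact: sigma_of_part.
Qed.

(** The marginal law is read off by letting the other coordinate range over the whole line, which
    has mass 1. *)
Lemma circular_normal_part (Z : T -> R[i]) (v : R) (b : bool) :
  circular_normal P Z v ->
  measurable_fun setT (fun t => part b (Z t)) /\
  (forall A, measurable A ->
    P ((fun t => part b (Z t)) @^-1` A) = centered_normal (v / 2) A).
Proof.
move=> [mRe mIm law]; split; first by case: b.
have cn1 : centered_normal (v / 2) (setT : set R) = 1%E.
  rewrite /centered_normal; case: ifP => _; first by rewrite diracT.
  exact: probability_setT.
move=> A mA; case: b.
  have := law A setT mA measurableT; rewrite cn1 mule1 => <-.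
  by congr (P _); apply/seteqP; split => t //= -[].
have := law setT A measurableT mA; rewrite cn1 mul1e => <-.
by congr (P _); apply/seteqP; split => t //= -[].
Qed.

Context (I : choiceType) (Ep : I -> R) (h : I -> nat -> T -> R[i]).
Hypothesis hEp : forall p, 0 <= Ep p.
Hypothesis hlaw : forall p k, circular_normal P (h p k) (Ep p).
Hypothesis hentries : forall p, mutually_independent P (fun k => sigma_of (h p k)).
Hypothesis htaps : mutually_independent P (fun p => sigma_of_seq (h p)).

Let X p b k t := part b (h p k t).

Let mX p b k : measurable_fun setT (X p b k).
Proof. exact: (circular_normal_part b (hlaw p k)).1. Qed.

Let v2_ge0 p : 0 <= Ep p / 2.
Proof. by rewrite divr_ge0. Qed.

Let momX p : exists K, forall b k,
  [/\ P.-integrable setT (fun t => (X p b k t ^+ 4)%:E),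
      \int[P]_t (X p b k t ^+ 4) = K,
      \int[P]_t X p b k t = 0 & \int[P]_t (X p b k t ^+ 2) = Ep p / 2].
Proof.
have [K HK] := centered_normal_moments P (v2_ge0 p); exists K => b k.
by apply: HK; [exact: mX|exact: (circular_normal_part b (hlaw p k)).2].
Qed.

Let int_le p b k (f : R -> R) (C : R) : measurable_fun setT f ->
  (forall x, `|f x| <= C + x ^+ 4) -> P.-integrable setT (fun t => (f (X p b k t))%:E).
Proof.
move=> mf fle; have [K /(_ b k) [i4 _ _ _]] := momX p.
apply: (@le_integrable _ _ _ P setT measurableT _
  (cst C%:E \+ (fun t => (X p b k t ^+ 4)%:E))%E).
- by apply/measurable_EFinP; apply: measurableT_comp => //; exact: mX.
- move=> x _ /=; rewrite lee_fin; apply: le_trans (ler_norm _); exact: fle.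
- by apply: integrableD => //; exact: finite_measure_integrable_cst.
Qed.

Let int1 p b k : P.-integrable setT (EFin \o X p b k).
Proof.
apply: (@int_le p b k id 2) => // x.
have : x ^+ 2 <= 1 + x ^+ 4 by have := sqr_ge0 (x ^+ 2 - 1); nra.
by have := sqr_ge0 (`|x| - 1); rewrite -[x ^+ 2]real_normK ?num_real//; nra.
Qed.

Let int2 p b k : P.-integrable setT (fun t => (X p b k t ^+ 2)%:E).
Proof.
apply: (@int_le p b k (fun x => x ^+ 2) 1) => [|x]; first exact: exprn_measurable.
by rewrite ger0_norm ?sqr_ge0//; have := sqr_ge0 (x ^+ 2 - 1); nra.
Qed.

Let indX p b b' k j (f g : R -> R) : k != j -> measurable_fun setT f ->
  measurable_fun setT g ->
  independent2 P (fun t => f (X p b k t)) (fun t => g (X p b' j t)).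
Proof.
move=> kj mf mg A B mA mB.
apply: (mutually_independent_pair (@hentries p) kj).
- apply: (@sigma_of_part (h p k) b (f @^-1` A)).
  by rewrite -[X in measurable X]setTI; exact: mf.
- apply: (@sigma_of_part (h p j) b' (g @^-1` B)).
  by rewrite -[X in measurable X]setTI; exact: mg.
Qed.

(** The centred squares [X^2 - s] are independent of mean zero, with common variance [K - s^2].
    Their averages therefore vanish along the perfect squares, and nonnegativity of [X^2] extends
    the limit to all [n]. *)
Lemma average_part_sqr_cvg (p : I) (b : bool) :
  {ae P, forall t, (\sum_(k < n) part b (h p k t) ^+ 2) / n%:R @[n --> \oo] --> Ep p / 2}.
Proof.
have [K momK] := momX p; set s := Ep p / 2.
pose Y k t := X p b k t ^+ 2 - s.
have mf : measurable_fun setT (fun x : R => x ^+ 2 - s).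
  by apply: measurable_funB => //; exact: exprn_measurable.
have mY k : measurable_fun setT (Y k).
  by apply: (measurableT_comp mf); exact: mX.
have iY k : P.-integrable setT (EFin \o Y k).
  apply: (@int_le p b k (fun x => x ^+ 2 - s) (1 + `|s|)) => // x.
  apply: le_trans (ler_normB _ _) _.
  by rewrite ger0_norm ?sqr_ge0//; have := sqr_ge0 (x ^+ 2 - 1); nra.
have ics : P.-integrable setT (fun t => s%:E) by exact: finite_measure_integrable_cst.
have Y0 k : \int[P]_t Y k t = 0.
  have [_ _ _ e2] := momK b k.
  rewrite RintegralB//; last exact: int2.
  by rewrite e2 Rintegral_probability_cst subrr.
have YYE k t : Y k t * Y k t = X p b k t ^+ 4 - (2 * s * X p b k t ^+ 2 - s ^+ 2).
  by rewrite /Y; ring.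
have ilin k : P.-integrable setT (fun t => (2 * s * X p b k t ^+ 2 - s ^+ 2)%:E).
  apply: (@int_le p b k (fun x => 2 * s * x ^+ 2 - s ^+ 2) (s ^+ 2 + s ^+ 2)) => [|x].
    by apply: measurable_funB => //; apply: (@measurable_funM _ _ _ _ (cst (2 * s)));
      [exact: measurable_cst|exact: exprn_measurable].
  have n1 : 0 <= 2 * s * x ^+ 2.
    by apply: mulr_ge0 (sqr_ge0 x); apply: mulr_ge0 => //; exact: v2_ge0.
  apply: le_trans (ler_normB _ _) _; rewrite (ger0_norm (sqr_ge0 s)) (ger0_norm n1).
  by have := sqr_ge0 (x ^+ 2 - s); nra.
have YY k j : k != j -> P.-integrable setT (fun t => (Y k t * Y j t)%:E) /\
    \int[P]_t (Y k t * Y j t) = 0.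
  move=> kj; have ind := indX p b b kj mf mf.
  have [-> ->] := independent2_integralM (mY k) (mY j) (iY k) (iY j) ind.
  by rewrite Y0 mul0r.
have iYY k j : P.-integrable setT (fun t => (Y k t * Y j t)%:E).
  have [<-|/YY[]//] := eqVneq k j.
  have [i4 _ _ _] := momK b k.
  by under eq_fun do rewrite YYE; exact: (integrableB measurableT i4 (ilin k)).
have := @orthogonal_sqr_average_cvg0 _ _ _ P Y (K - s ^+ 2) iYY mY
  (fun k j kj => (YY k j kj).2) _.
have E2 k : \int[P]_t (Y k t * Y k t) <= K - s ^+ 2.
  have [i4 e4 _ e2] := momK b k.
  have i2 : P.-integrable setT (fun t => (2 * s * X p b k t ^+ 2)%:E).
    by under eq_fun do rewrite EFinM; apply: integrableZl => //; exact: int2.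
  have ic : P.-integrable setT (fun t => (s ^+ 2)%:E).
    exact: finite_measure_integrable_cst.
  under eq_Rintegral do rewrite YYE.
  rewrite (RintegralB measurableT i4 (ilin k)) e4 (RintegralB measurableT i2 ic).
  rewrite (RintegralZl _ measurableT (int2 p b k)) e2 Rintegral_probability_cst -/s.
  by nra.
move=> /(_ E2); apply: filterS => t Ht.
apply: (@average_cvg_of_sqr _ (fun k => part b (h p k t) ^+ 2)) => [k|].
  exact: sqr_ge0.
have -> : (fun n => (\sum_(k < n.+1 ^ 2) part b (h p k t) ^+ 2) / (n.+1 ^ 2)%:R) =
   (fun n => (\sum_(k < n.+1 ^ 2) Y k t) / (n.+1 ^ 2)%:R + s).
  apply/funext => n; rewrite /Y sumrB sumr_const card_ord mulrBl -[s *+ _]mulr_natr.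
  by rewrite mulfK ?subrK// pnatr_eq0 expn_eq0.
by rewrite -[X in _ --> X]add0r; apply: cvgD => //; exact: cvg_cst.
Qed.

(** Two kinds of independence combine: that between taps separates the factors from [p] and from
    [q], and that between entries of one tap makes the products at distinct indices orthogonal. *)
Lemma average_part_mul_cvg (p q : I) (b c : bool) : p != q ->
  {ae P, forall t,
    (\sum_(k < n) part b (h p k t) * part c (h q k t)) / n%:R @[n --> \oo] --> (0 : R)}.
Proof.
move=> pq.
have XX r e k j : P.-integrable setT (fun t => (X r e k t * X r e j t)%:E) /\
    \int[P]_t (X r e k t * X r e j t) = if k == j then Ep r / 2 else 0.
  have [K momK] := momX r; have [<-|kj] := eqVneq k j.
    have [_ _ _ e2] := momK e k.
    by split; [exact: int2|rewrite -e2].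
  have ind := indX r e e kj (@measurable_id _ R setT) (@measurable_id _ R setT).
  have [-> ->] := independent2_integralM (mX r e k) (mX r e j)
    (int1 r e k) (int1 r e j) ind.
  by have [_ _ -> _] := momK e k; rewrite mul0r.
have mXX r e k j : measurable_fun setT (fun t => X r e k t * X r e j t).
  by apply: measurable_funM; exact: mX.
have sXX r e k j A : measurable A ->
    sigma_of_seq (h r) ((fun t => X r e k t * X r e j t) @^-1` A).
  move=> mA; rewrite -[X in sigma_of_seq _ X]setTI.
  by apply: (measurable_funM (@measurable_part_seq (h r) e k)
    (@measurable_part_seq (h r) e j)).
pose Y k t := X p b k t * X q c k t.
(* Regrouping by tap rather than by entry index lets the independence of the taps factor the
   expectation. *)
have YYE k j t : Y k t * Y j t = (X p b k t * X p b j t) * (X q c k t * X q c j t).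
  by rewrite /Y; ring.
have YY k j : P.-integrable setT (fun t => (Y k t * Y j t)%:E) /\
    \int[P]_t (Y k t * Y j t) = if k == j then Ep p / 2 * (Ep q / 2) else 0.
  have [ip ep] := XX p b k j; have [iq eq] := XX q c k j.
  under eq_fun do rewrite YYE; under eq_Rintegral do rewrite YYE.
  have [|-> ->] := independent2_integralM (mXX p b k j) (mXX q c k j) ip iq.
    by move=> A B mA mB; apply: (mutually_independent_pair htaps pq); exact: sXX.
  by rewrite ep eq; case: ifP; rewrite ?mul0r.
have mY k : measurable_fun setT (Y k) by apply: measurable_funM; exact: mX.
have YC k : \int[P]_t (Y k t * Y k t) <= Ep p / 2 * (Ep q / 2) by rewrite (YY k k).2 eqxx.
have Y0 k j : k != j -> \int[P]_t (Y k t * Y j t) = 0.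
  by move=> kj; rewrite (YY k j).2 (negbTE kj).
have H := @orthogonal_sqr_average_cvg0 _ _ _ P Y _ (fun k j => (YY k j).1) mY Y0 YC.
have Hp := average_part_sqr_cvg p b; have Hq := average_part_sqr_cvg q c.
apply: filterS3 H Hp Hq => t Ht Hpt Hqt.
exact: (@average_mul_cvg _ (fun k => part b (h p k t)) (fun k => part c (h q k t))
  _ _ Hpt Hqt Ht).
Qed.

End tap_averages.

(** * Quadratic forms in the Gram averages *)

Section complex_limits.
Context (R : realType).
Implicit Types (u v : nat -> R[i]) (z w : R[i]).

Lemma normc_sqr z : normc z ^+ 2 = complex.Re z ^+ 2 + complex.Im z ^+ 2.
Proof. by case: z => a b /=; rewrite sqr_sqrtr// addr_ge0 ?sqr_ge0. Qed.

Lemma mulc_conjc z : z * conjc z = (normc z ^+ 2)%:C.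
Proof.
rewrite normc_sqr; case: z => a b /=; simpc; apply/eqP.
by rewrite eq_complex/=; apply/andP; split; apply/eqP; ring.
Qed.

Lemma expj_conjc (x : R) : expj x * conjc (expj x) = 1.
Proof. by rewrite mulc_conjc normc_sqr/= cos2Dsin2. Qed.

(** Complex limits are taken coordinatewise, since the averages above concern real and imaginary
    parts. *)
Definition ccvg u z :=
  complex.Re (u n) @[n --> \oo] --> complex.Re z /\
  complex.Im (u n) @[n --> \oo] --> complex.Im z.

Lemma ccvgD u v z w : ccvg u z -> ccvg v w -> ccvg (fun n => u n + v n) (z + w).
Proof.
move=> [ur ui] [vr vi]; split; rewrite raddfD; under eq_fun do rewrite raddfD;
  exact: cvgD.
Qed.

Lemma ccvgMl z u w : ccvg u w -> ccvg (fun n => z * u n) (z * w).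
Proof.
have ReM x y : complex.Re (x * y) =
    complex.Re x * complex.Re y - complex.Im x * complex.Im y :> R.
  by case: x y => [a b] [].
have ImM x y : complex.Im (x * y) =
    complex.Re x * complex.Im y + complex.Im x * complex.Re y :> R.
  by case: x y => [a b] [].
move=> [ur ui]; split; rewrite ?ReM ?ImM; under eq_fun do rewrite ?ReM ?ImM.
- by apply: cvgB; apply: cvgM => //; exact: cvg_cst.
- by apply: cvgD; apply: cvgM => //; exact: cvg_cst.
Qed.

Lemma ccvg_sum (I : Type) (s : seq I) (f : I -> nat -> R[i]) (g : I -> R[i]) :
  (forall i, ccvg (f i) (g i)) -> ccvg (fun n => \sum_(i <- s) f i n) (\sum_(i <- s) g i).
Proof.
move=> fg; elim: s => [|i s IH].
  rewrite big_nil; split; under eq_fun do rewrite big_nil; exact: cvg_cst.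
rewrite big_cons.
have [hr hi] := ccvgD (fg i) IH.
by split; under eq_fun do rewrite big_cons.
Qed.

Lemma ccvg_normc_sqr u z : ccvg u z ->
  normc (u n) ^+ 2 @[n --> \oo] --> normc z ^+ 2.
Proof.
move=> [ur ui]; rewrite normc_sqr; under eq_fun do rewrite normc_sqr.
by rewrite !expr2; under eq_fun do rewrite !expr2; apply: cvgD; exact: cvgM.
Qed.

End complex_limits.

(** * Linear combinations of the taps and their inner products *)

Section combinations.
Context (R : realType) (L : nat) (h : 'I_L -> nat -> R[i]).
Implicit Types (a b : 'I_L -> R[i]) (N : nat).

Definition comb a N : 'cV[R[i]]_N := \sum_p a p *: \col_(k < N) h p k.

Definition gram (p q : 'I_L) N : R[i] :=
  (N%:R^-1)%:C * \sum_(k < N) h p k * conjc (h q k).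

(** This is the Hermitian inner product of [comb a N] and [comb b N], divided by [N]. *)
Definition form a b N : R[i] := \sum_p \sum_q a p * conjc (b q) * gram p q N.

Lemma combE a N k : comb a N k 0 = \sum_p a p * h p k.
Proof. by rewrite summxE; apply: eq_bigr => p _; rewrite !mxE. Qed.

Lemma dotTC N (u v : 'cV[R[i]]_N) : dotT u v = dotT v u.
Proof.
by rewrite /dotT !mxE; apply: eq_bigr => k _; rewrite !mxE mulrC.
Qed.

Lemma dotTZr N (u v : 'cV[R[i]]_N) c : dotT u (c *: v) = c * dotT u v.
Proof. by rewrite /dotT -scalemxAr mxE. Qed.

Lemma dotT_comb a b N :
  dotT (comb a N) (map_mx conjc (comb b N)) = N%:R * form a b N.
Proof.
have [->|N0] := posnP N; first by rewrite mul0r /dotT mxE big_ord0.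
have NC : N%:R * (N%:R^-1)%:C = 1 :> R[i].
  have -> : N%:R = (N%:R)%:C :> R[i] by rewrite rmorph_nat.
  by rewrite -rmorphM/= divff ?rmorph1// pnatr_eq0 -lt0n.
rewrite /form mulr_sumr.
under eq_bigr => p _.
  rewrite mulr_sumr.
  under eq_bigr => q _ do rewrite /gram mulrCA (mulrA N%:R) NC mul1r mulr_sumr.
  rewrite exchange_big/=.
  over.
rewrite exchange_big/= /dotT mxE; apply: eq_bigr => k _.
rewrite !mxE !combE rmorph_sum/= big_distrlr/=.
apply: eq_bigr => p _; apply: eq_bigr => q _.
by rewrite rmorphM/= mulrACA.
Qed.

Lemma vnorm_comb_sqr b N : vnorm (comb b N) ^+ 2 = N%:R * complex.Re (form b b N).
Proof.
have /(congr1 (@complex.Re _)) : ((vnorm (comb b N) ^+ 2)%:C = N%:R * form b b N :> R[i]).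
  rewrite -dotT_comb /vnorm sqr_sqrtr; last by apply: sumr_ge0 => k _; exact: sqr_ge0.
  by rewrite rmorph_sum/= /dotT mxE; apply: eq_bigr => k _; rewrite !mxE mulc_conjc.
rewrite /= => ->.
have -> : N%:R = (N%:R)%:C :> R[i] by rewrite rmorph_nat.
by case: (form b b N) => x y /=; rewrite mul0r subr0.
Qed.

(* With a null vector the identity reads 0 = 0, by x / 0 = 0. *)
Lemma normc_dotT_normalized a b N :
  normc (dotT (comb a N) (((vnorm (comb b N))^-1)%:C *: map_mx conjc (comb b N))) ^+ 2 =
  N%:R * (normc (form a b N) ^+ 2 / complex.Re (form b b N)).
Proof.
rewrite dotTZr dotT_comb !normcM !exprMn.
have -> : normc ((vnorm (comb b N))^-1)%:C ^+ 2 = (vnorm (comb b N) ^+ 2)^-1.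
  by rewrite normc_sqr/= expr0n/= addr0 exprVn.
have -> : normc (N%:R : R[i]) ^+ 2 = N%:R ^+ 2.
  have -> : N%:R = (N%:R)%:C :> R[i] by rewrite rmorph_nat.
  by rewrite normc_sqr/= expr0n/= addr0.
rewrite vnorm_comb_sqr; have [->|N0] := posnP N; first by rewrite !mul0r invr0 mul0r.
have Nn0 : N%:R != 0 :> R by rewrite pnatr_eq0 -lt0n.
by rewrite invfM mulrACA (expr2 N%:R) (mulKf Nn0) [X in _ * X]mulrC.
Qed.

(** The limiting Gram matrix is diagonal, so the double sum collapses to a single one. *)
Lemma form_ccvg a b (E : 'I_L -> R) :
  (forall p q, ccvg (gram p q) (if p == q then (E p)%:C else 0)) ->
  ccvg (form a b) (\sum_p a p * conjc (b p) * (E p)%:C).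
Proof.
move=> gE.
have -> : \sum_p a p * conjc (b p) * (E p)%:C =
    \sum_p \sum_q a p * conjc (b q) * (if p == q then (E p)%:C else 0).
  apply: eq_bigr => p _; rewrite (bigD1 p)//= eqxx big1 ?addr0// => q qp.
  by rewrite eq_sym (negbTE qp) mulr0.
by apply: ccvg_sum => p; apply: ccvg_sum => q; apply: ccvgMl.
Qed.

(** The real part is the sum of two like-part averages, each contributing [E p / 2] when [p = q].
    The imaginary part is a difference of two mixed averages, which coincide when [p = q]. For
    distinct taps all four averages vanish in the limit. *)
Lemma gram_ccvg (E : 'I_L -> R) :
  (forall p (e : bool),
    (\sum_(k < n) part e (h p k) ^+ 2) / n%:R @[n --> \oo] --> E p / 2) ->
  (forall p q (e f : bool), p != q ->
    (\sum_(k < n) part e (h p k) * part f (h q k)) / n%:R @[n --> \oo] --> (0 : R)) ->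
  forall p q, ccvg (gram p q) (if p == q then (E p)%:C else 0).
Proof.
move=> hsq hmul p q.
have ReE n : complex.Re (gram p q n) =
    (\sum_(k < n) part true (h p k) * part true (h q k)) / n%:R +
    (\sum_(k < n) part false (h p k) * part false (h q k)) / n%:R.
  rewrite /gram; set S := \sum_(k < n) _.
  have -> : complex.Re ((n%:R^-1)%:C * S) = n%:R^-1 * complex.Re S.
    by case: S => x y /=; rewrite mul0r subr0.
  rewrite mulrC -mulrDl; congr (_ * _); rewrite /S raddf_sum -big_split/=.
  by apply: eq_bigr => k _; case: (h p k) (h q k) => [x y] [z w] /=; rewrite mulrN opprK.
have ImE n : complex.Im (gram p q n) =
    (\sum_(k < n) part false (h p k) * part true (h q k)) / n%:R -
    (\sum_(k < n) part true (h p k) * part false (h q k)) / n%:R.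
  rewrite /gram; set S := \sum_(k < n) _.
  have -> : complex.Im ((n%:R^-1)%:C * S) = n%:R^-1 * complex.Im S.
    by case: S => x y /=; rewrite mul0r addr0.
  rewrite mulrC -mulrBl; congr (_ * _); rewrite /S raddf_sum -sumrB/=.
  by apply: eq_bigr => k _; case: (h p k) (h q k) => [x y] [z w] /=; rewrite mulrN addrC.
split; [under eq_fun do rewrite ReE|under eq_fun do rewrite ImE].
- have [<-|pq] := eqVneq p q.
    have := cvgD (hsq p true) (hsq p false); rewrite -splitr => c.
    exact: c.
  have := cvgD (hmul p q true true pq) (hmul p q false false pq).
  by rewrite addr0 => c; exact: c.
- have [<-|pq] := eqVneq p q.
    have -> : (fun n => (\sum_(k < n) part false (h p k) * part true (h p k)) / n%:R -
      (\sum_(k < n) part true (h p k) * part false (h p k)) / n%:R) = (fun=> 0).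
      apply/funext => n; rewrite -mulrBl -sumrB big1 ?mul0r// => k _.
      by rewrite mulrC subrr.
    exact: cvg_cst.
  have := cvgB (hmul p q false true pq) (hmul p q true false pq).
  by rewrite subr0 => c; exact: c.
Qed.

End combinations.

(** * Convergence of the SINR for a fixed realization of the taps *)

Section sinr.
Context (R : realType) (Nfft Nsc Ncp L tau : nat).

(** Taps within the cyclic prefix cause no self-interference, so that sum may start at [Ncp + 1]. At
    [m = 0] the first branch of the weight applies, and also gives 1. *)
Lemma c_weight_cp (m : nat) : (0 < Nfft)%N -> (m <= Ncp)%N ->
  c_weight R Nfft Ncp m%:Z = 1.
Proof.
move=> N0 mcp; rewrite /c_weight; case: m mcp => [|m] mcp.
  by rewrite lexx andbT oppr_le0 lez_nat leq0n addr0 divff// pnatr_eq0 -lt0n.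
by rewrite !lez_nat mcp ltn0 andbF /=.
Qed.

(** The channel [hhat0] starts at tap [Ncp] but the limit at [Ncp + 1]; the boundary term vanishes.
    For [Ncp = 0] it falls in the first branch, where the phase is that of angle 0. *)
Lemma ctilde_cp (l i : nat) : (0 < Nfft)%N -> l != i ->
  ctilde R Nfft Ncp l i Ncp%:Z = 0.
Proof.
move=> N0 li; rewrite /ctilde (negbTE li).
have expj0 : expj (0 : R) = 1 by rewrite /expj cos0 sin0.
case: ifP => [/andP[_]|_].
  rewrite lez_nat leqn0 => /eqP->.
  by rewrite mulr0 !mul0r expj0 subrr mul0r.
case: ifP => // _.
by rewrite subrr mulr0 !mul0r expj0 subrr mul0r.
Qed.

Context (h : 'I_L -> nat -> R[i]) (E : 'I_L -> R).
Hypothesis Nfft_gt0 : (0 < Nfft)%N.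
Hypothesis Etau : 0 < \sum_(p < L | (p < tau)%N) E p.
Hypothesis gramE : forall p q, ccvg (gram h p q) (if p == q then (E p)%:C else 0).

Let H N (p : 'I_L) : 'cV[R[i]]_N := \col_(k < N) h p k.

Let tw (l : nat) (p : 'I_L) : R[i] := twiddle R Nfft l p.

(** Extension by zero makes the truncated channel a combination of all the taps. *)
Let beta (l : nat) (p : 'I_L) : R[i] := if (p < tau)%N then tw l p else 0.

(** Each channel in the SINR carries the same phases [tw l p] as the precoder it meets, so in the
    diagonal limit every phase is multiplied by its own conjugate and only [g] survives. *)
Let beta_lim (l : nat) (g : 'I_L -> R[i]) :
  ccvg (form h (fun p => g p * tw l p) (beta l))
    (\sum_(p < L | (p < tau)%N) g p * (E p)%:C).
Proof.
have := form_ccvg (fun p => g p * tw l p) (beta l) gramE.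
congr ccvg; rewrite [RHS]big_mkcond; apply: eq_bigr => p _; rewrite /beta.
case: ifP => _; last by rewrite rmorph0 mulr0 mul0r.
by rewrite -(mulrA (g p)) expj_conjc mulr1.
Qed.

Let A (l N : nat) : R := complex.Re (form h (beta l) (beta l) N).

Let A_lim l : A l n @[n --> \oo] --> \sum_(p < L | (p < tau)%N) E p.
Proof.
have := beta_lim l (fun p => if (p < tau)%N then 1 else 0).
have -> : (fun p : 'I_L => (if (p < tau)%N then 1 else 0) * tw l p) = beta l.
  by apply/funext => p; rewrite /beta; case: ifP; rewrite ?mul1r ?mul0r.
have -> : \sum_(p < L | (p < tau)%N) (if (p < tau)%N then 1 else 0) * (E p)%:C =
    (\sum_(p < L | (p < tau)%N) E p)%:C :> R[i].
  by rewrite rmorph_sum; apply: eq_bigr => p ->; rewrite mul1r.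
by case.
Qed.

Let hhat_truncE N l : hhat_trunc Nfft tau (H N) l = comb h (beta l) N.
Proof.
rewrite /hhat_trunc big_mkcond; apply: eq_bigr => p _; rewrite /beta.
by case: ifP; rewrite ?scale0r.
Qed.

Let hhatB N i : hhat Nfft (H N) i - hhat0_diag Nfft Ncp (H N) i =
  comb h (fun p => (1 - c_weight R Nfft Ncp p%:Z)%:C * tw i p) N.
Proof.
rewrite -sumrB; apply: eq_bigr => p _; rewrite -scalerBl; congr (_ *: _).
by rewrite rmorphB rmorph1 mulrBl mul1r.
Qed.

Let hhat0E N l i : hhat0 Nfft Ncp (H N) l i =
  comb h (fun p => (if (Ncp <= p)%N then ctilde R Nfft Ncp l i p%:Z else 0) * tw l p) N.
Proof.
rewrite /hhat0 big_mkcond; apply: eq_bigr => p _.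
by case: ifP; rewrite ?mul0r ?scale0r.
Qed.

(** [N * power l g N] is the squared modulus of the product of precoder [l] with the channel of
    weights [g p * tw l p]. *)
Let power (l : nat) (g : 'I_L -> R[i]) N :=
  normc (form h (fun p => g p * tw l p) (beta l) N) ^+ 2 / A l N.

Let power_lim l (g : 'I_L -> R[i]) : power l g n @[n --> \oo] -->
  normc (\sum_(p < L | (p < tau)%N) g p * (E p)%:C) ^+ 2 / \sum_(p < L | (p < tau)%N) E p.
Proof.
apply: cvgM; first exact: ccvg_normc_sqr (beta_lim l g).
by apply: cvgV; [rewrite gt_eqF|exact: A_lim].
Qed.

Lemma SINR_cvg (snr_op : R) (i : 'I_Nsc) : 0 < snr_op ->
  (fun N : nat => SINR Nfft Ncp (H N) (fun l : 'I_Nsc => precoder Nfft tau (H N) l)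
     (snr_op / N%:R) i) @ \oo --> SINR_limit Nfft Ncp tau E snr_op i.
Proof.
move=> snr0.
pose cc (p : 'I_L) := c_weight R Nfft Ncp p%:Z.
pose ct (l : nat) (p : 'I_L) := if (Ncp <= p)%N then ctilde R Nfft Ncp l i p%:Z else 0.
pose al := \sum_(p < L | (p < tau)%N) E p.
pose ratio N := power i (fun p => (cc p)%:C) N /
  (power i (fun p => (1 - cc p)%:C) N +
   \sum_(l < Nsc | l != i) 2 * power l (ct l) N + 1 / snr_op).
have dotE (l : 'I_Nsc) (g : 'I_L -> R[i]) N :
    normc (dotT (comb h (fun p => g p * tw l p) N) (precoder Nfft tau (H N) l)) ^+ 2 =
    N%:R * power l g N.
  by rewrite /precoder hhat_truncE normc_dotT_normalized.
(* Since the SNR is [snr_op / N], the noise term also grows like [N], and the factor [N] cancels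
   throughout. *)
have cancelN (n k x y z : R) : n != 0 -> k != 0 ->
    n * x / (n * y + n * z + 1 / (k / n)) = x / (y + z + 1 / k).
  move=> n0 k0; have -> : n * y + n * z + 1 / (k / n) = n * (y + z + 1 / k).
    by field; apply/andP; split.
  by rewrite -mulf_div divff// mul1r.
have SINRE : (fun N : nat => SINR Nfft Ncp (H N)
    (fun l : 'I_Nsc => precoder Nfft tau (H N) l) (snr_op / N%:R) i) = ratio.
  apply/funext => N; rewrite /ratio.
  have diagE : normc (dotT (hhat0_diag Nfft Ncp (H N) i)
      (precoder Nfft tau (H N) i)) ^+ 2 =
      N%:R * power i (fun p => (cc p)%:C) N.
    exact: (dotE i (fun p => (cc p)%:C) N).
  have restE : normc (dotT (precoder Nfft tau (H N) i)
      (hhat Nfft (H N) i - hhat0_diag Nfft Ncp (H N) i)) ^+ 2 =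
      N%:R * power i (fun p => (1 - cc p)%:C) N by rewrite dotTC hhatB dotE.
  have crossE : \sum_(l < Nsc | l != i)
      2 * normc (dotT (hhat0 Nfft Ncp (H N) l i) (precoder Nfft tau (H N) l)) ^+ 2 =
      N%:R * \sum_(l < Nsc | l != i) 2 * power l (ct l) N.
    rewrite mulr_sumr; apply: eq_bigr => l _.
    by rewrite hhat0E (dotE l (ct l)) mulrCA.
  transitivity (N%:R * power i (fun p => (cc p)%:C) N /
      (N%:R * power i (fun p => (1 - cc p)%:C) N +
       N%:R * \sum_(l < Nsc | l != i) 2 * power l (ct l) N + 1 / (snr_op / N%:R))).
    by congr (_ / (_ + _ + _)).
  (* Without antennas both sides are 0, because the Gram sums in the numerator are empty. *)
  have [->|N0] := posnP N.
    rewrite !mul0r {1}/power /form big1 ?Normc.normc0 ?expr0n ?mul0r// => p _.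
    by rewrite big1// => q _; rewrite /gram big_ord0 !mulr0.
  by apply: cancelN; rewrite ?pnatr_eq0 -?lt0n// gt_eqF.
rewrite SINRE.
have lim : ratio n @[n --> \oo] -->
    (normc (\sum_(p < L | (p < tau)%N) (cc p)%:C * (E p)%:C) ^+ 2 / al) /
    (normc (\sum_(p < L | (p < tau)%N) (1 - cc p)%:C * (E p)%:C) ^+ 2 / al +
     \sum_(l < Nsc | l != i)
       2 * (normc (\sum_(p < L | (p < tau)%N) ct l p * (E p)%:C) ^+ 2 / al) + 1 / snr_op).
  apply: cvgM; first exact: power_lim.
  apply: cvgV.
    (* The noise term [1 / snr_op] keeps the limiting denominator positive. *)
    rewrite gt_eqF// ltr_wpDl ?divr_gt0// addr_ge0 ?divr_ge0 ?sqr_ge0 ?(ltW Etau)//.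
    by apply: sumr_ge0 => l _; rewrite mulr_ge0// divr_ge0 ?sqr_ge0// ltW.
  apply: cvgD; last exact: cvg_cst.
  apply: cvgD; first exact: power_lim.
  apply: cvg_big => [|l _]; first exact: add_continuous.
  apply: cvgM; [exact: cvg_cst|exact: power_lim].
have normcR (x : R) : normc (x%:C) ^+ 2 = x ^+ 2.
  by rewrite normc_sqr/= expr0n/= addr0.
have realS (f : 'I_L -> R) : \sum_(p < L | (p < tau)%N) (f p)%:C * (E p)%:C =
    (\sum_(p < L | (p < tau)%N) f p * E p)%:C.
  by rewrite rmorph_sum; apply: eq_bigr => p _; rewrite rmorphM.
suff -> : SINR_limit Nfft Ncp tau E snr_op i =
    (normc (\sum_(p < L | (p < tau)%N) (cc p)%:C * (E p)%:C) ^+ 2 / al) /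
    (normc (\sum_(p < L | (p < tau)%N) (1 - cc p)%:C * (E p)%:C) ^+ 2 / al +
     \sum_(l < Nsc | l != i)
       2 * (normc (\sum_(p < L | (p < tau)%N) ct l p * (E p)%:C) ^+ 2 / al) + 1 / snr_op).
  exact: lim.
rewrite /SINR_limit (bigD1 i)//= -/al.
(* The term [l = i] of the limit is the self-interference of the SINR; the taps up to [Ncp] that are
   missing on the left have [1 - cc p = 0]. *)
have -> : 2 * normc (\sum_(p < L | (Ncp < p < tau)%N)
      ctilde R Nfft Ncp i i p%:Z * (E p)%:C) ^+ 2 =
    normc (\sum_(p < L | (p < tau)%N) (1 - cc p)%:C * (E p)%:C) ^+ 2.
  have -> : \sum_(p < L | (Ncp < p < tau)%N) ctilde R Nfft Ncp i i p%:Z * (E p)%:C =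
      (((Num.sqrt 2)^-1)%:C * \sum_(p < L | (p < tau)%N) (1 - cc p)%:C * (E p)%:C).
    rewrite mulr_sumr big_mkcond [RHS]big_mkcond; apply: eq_bigr => p _.
    rewrite andbC; case: (p < tau)%N => //; rewrite andTb; case: ltnP => [_|pcp].
      by rewrite /ctilde eqxx mulrA; congr (_ * _); rewrite -rmorphM/= [in RHS]mulrC.
    by rewrite /cc c_weight_cp// subrr mul0r mulr0.
  rewrite normcM exprMn normcR exprVn sqr_sqrtr//.
  by apply: mulVKf; rewrite pnatr_eq0.
have -> : \sum_(l < Nsc | l != i)
      2 * normc (\sum_(p < L | (Ncp < p < tau)%N)
        ctilde R Nfft Ncp l i p%:Z * (E p)%:C) ^+ 2
    = \sum_(l < Nsc | l != i)
      2 * normc (\sum_(p < L | (p < tau)%N) ct l p * (E p)%:C) ^+ 2.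
  apply: eq_bigr => l li; congr (_ * normc _ ^+ 2).
  rewrite big_mkcond [RHS]big_mkcond; apply: eq_bigr => p _.
  rewrite andbC /ct; case: (p < tau)%N => //=.
  case: ltngtP => [//|_|<-]; rewrite ?mul0r//.
  by rewrite ctilde_cp// mul0r.
rewrite !realS !normcR.
have -> : \sum_(l < Nsc | l != i)
      2 * (normc (\sum_(p < L | (p < tau)%N) ct l p * (E p)%:C) ^+ 2 / al) =
    (\sum_(l < Nsc | l != i)
      2 * normc (\sum_(p < L | (p < tau)%N) ct l p * (E p)%:C) ^+ 2) / al.
  by rewrite mulr_suml; apply: eq_bigr => l _; exact: mulrA.
have al0 : al != 0 by rewrite gt_eqF.
(* Multiplying numerator and denominator by [al] moves the norm of the precoder onto the noise
   term. *)
have cancel_al (X B S : R) :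
    X / (B + S + al * snr_op^-1) = X / al / (B / al + S / al + 1 / snr_op).
  have -> : B / al + S / al + 1 / snr_op = (B + S + al * snr_op^-1) / al.
    by field; rewrite al0 gt_eqF.
  by rewrite invf_div mulrA divfK.
exact: cancel_al.
Qed.

End sinr.

Theorem proposition1 (R : realType) (d : measure_display)
    (T : measurableType d) (P : probability T R)
    (Nfft Nsc Ncp L tau : nat)
    (hNfft : (1 <= Nfft)%N) (hNsc : (1 <= Nsc <= Nfft)%N)
    (hL : (1 <= L <= Nfft)%N) (htau : (1 <= tau <= L)%N)
    (Ep : 'I_L -> R) (hEp : forall p, 0 <= Ep p)
    (hEtau : 0 < \sum_(p < L | (p < tau)%N) Ep p)
    (* h p k t is entry k of tap p at the outcome t *)
    (h : 'I_L -> nat -> T -> R[i])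
    (hlaw : forall p k, circular_normal P (h p k) (Ep p))
    (hentries : forall p, mutually_independent P (fun k => sigma_of (h p k)))
    (htaps : mutually_independent P (fun p => sigma_of_seq (h p)))
    (snr_op : R) (hsnr : 0 < snr_op) (i : 'I_Nsc) :
  {ae P, forall t,
    (fun Nt : nat =>
       let H (p : 'I_L) : 'cV[R[i]]_Nt := \col_(k < Nt) h p k t in
       SINR Nfft Ncp H (fun l : 'I_Nsc => precoder Nfft tau H l)
         (snr_op / Nt%:R) i)
      @ \oo --> SINR_limit Nfft Ncp tau Ep snr_op i}.
Proof.
(* There are finitely many taps and parts, so one null set serves for all of them. *)
have sqr_ae : {ae P, forall t, forall (p : 'I_L) (e : bool),
    (\sum_(k < n) part e (h p k t) ^+ 2) / n%:R @[n --> \oo] --> Ep p / 2}.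
  apply: filter_forall => p; apply: filter_forall => e.
  exact: average_part_sqr_cvg.
have mul_ae : {ae P, forall t, forall (p q : 'I_L) (e f : bool), p != q ->
    (\sum_(k < n) part e (h p k t) * part f (h q k t)) / n%:R @[n --> \oo] --> (0 : R)}.
  apply: filter_forall => p; apply: filter_forall => q.
  apply: filter_forall => e; apply: filter_forall => f.
  have [->|pq] := eqVneq p q; first by apply: aeW.
  by apply: filterS (average_part_mul_cvg hEp hlaw hentries htaps e f pq).
(* Outside the two null sets the rest is deterministic at the fixed outcome [t]. *)
apply: filterS2 sqr_ae mul_ae => t sqr_t mul_t.
have gramE := @gram_ccvg _ _ (fun p k => h p k t) Ep sqr_t mul_t.
exact: (@SINR_cvg _ _ _ Ncp _ _ _ _ hNfft hEtau gramE snr_op i hsnr).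
Qed.
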